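(* Let $\boldsymbol\gamma=\{\gamma_n\}_{n=0}^{\infty}$ be a CPD sequence of real numbers such that $\limsup_{n\to\infty}|\gamma_n|^{1/n}<\infty$ and let $(b,c,\nu)$ be the representing triplet of $\boldsymbol\gamma$. Suppose $\operatorname{supp}(\nu)\subseteq\mathbb{R}_+$ and $\gamma_n\geq0$ for $n$ large enough. Then the following conditions are equivalent: (i) $\lim_{n\to\infty}(\gamma_{n+1}-\gamma_n)=0$; (ii) the sequence $\boldsymbol\gamma$ is monotonically decreasing; (iii) the sequence $\boldsymbol\gamma$ is convergent in $\mathbb{R}$. Moreover, if (i) holds, then $\boldsymbol\gamma$ is PD and $\gamma_n\geq0$ for all $n\in\mathbb{Z}_+$.
   Context: $\mathbb{Z}_+=\{0,1,2,\ldots\}$, $\mathbb{R}_+=[0,\infty)$; measures are positive; $\operatorname{supp}(\nu)$ is the closed support; ''monotonically decreasing'' means nonincreasing. A real sequence $\{\gamma_n\}_{n=0}^\infty$ is positive definite (PD) if $\sum_{i,j=0}^k \gamma_{i+j}\lambda_i\bar\lambda_j\geq 0$ for all finite complex sequences $\lambda_0,\ldots,\lambda_k$; it is conditionally positive definite (CPD) if the same inequality holds for all finite complex sequences with $\sum_{i=0}^k\lambda_i=0$. Let $Q_0=Q_1=0$ and $Q_n(x)=\sum_{j=0}^{n-2}(n-j-1)x^j$ for $n\geq2$. For a CPD sequence with $\limsup_{n\to\infty}|\gamma_n|^{1/n}<\infty$ there is a unique triplet $(b,c,\nu)$, called its representing triplet, with $b\in\mathbb{R}$, $c\in\mathbb{R}_+$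 and $\nu$ a finite compactly supported Borel measure on $\mathbb{R}$ with $\nu(\{1\})=0$, such that $\gamma_n=\gamma_0+bn+cn^2+\int_{\mathbb{R}}Q_n\,\mathrm{d}\nu$ for all $n\in\mathbb{Z}_+$. *)

(* Defs.v *)
From HB Require Import structures.
From mathcomp Require Export all_boot all_order all_algebra.
From mathcomp Require Export all_classical all_reals all_analysis.
From mathcomp Require Export complex.
Export Order.TTheory GRing.Theory Num.Theory numFieldNormedType.Exports.

Set Implicit Arguments.
Unset Strict Implicit.
Unset Printing Implicit Defensive.

Local Open Scope classical_set_scope.
Local Open Scope ring_scope.
Local Open Scope complex_scope.

(* On [R[i]], [0 <= z] says that [z] is real and nonnegative. *)
Definition PD (R : realType) (gamma : R^nat) : Prop :=
  forall (k : nat) (lam : 'I_k.+1 -> R[i]),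
    0 <= \sum_(i < k.+1) \sum_(j < k.+1)
           (gamma (i + j)%N)%:C * lam i * (lam j)^*.

Definition CPD (R : realType) (gamma : R^nat) : Prop :=
  forall (k : nat) (lam : 'I_k.+1 -> R[i]),
    \sum_(i < k.+1) lam i = 0 ->
    0 <= \sum_(i < k.+1) \sum_(j < k.+1)
           (gamma (i + j)%N)%:C * lam i * (lam j)^*.

(* The term of index [0], where [0^-1 = 0], does not affect the upper limit. *)
Definition exp_growth (R : realType) (gamma : R^nat) : Prop :=
  (limn_esup (fun n => (`|gamma n| `^ (n%:R^-1))%:E) < +oo)%E.

Definition Qpoly (R : realType) (n : nat) : {poly R} :=
  \poly_(j < n.-1) (n - j - 1)%N%:R.

Definition measure_supp (R : realType)
    (nu : {measure set (measurableTypeR R) -> \bar R}) : set R :=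
  [set x : R | forall U : set R, open U -> U x -> (0 < nu U)%E].

Definition representing_triplet (R : realType) (gamma : R^nat) (b c : R)
    (nu : {finite_measure set (measurableTypeR R) -> \bar R}) : Prop :=
  [/\ 0 <= c,
      compact (measure_supp nu),
      nu [set 1] = 0%E &
      forall n : nat,
        gamma n = gamma 0%N + b * n%:R + c * n%:R ^+ 2
                  + \int[nu]_x (Qpoly R n).[x]].

(* Main.v *)
(** The second difference of [gamma] is [2c + \int x^n dnu], which is nonnegative
    because [nu] lives on the half-line, so the first difference is
    nondecreasing: if it tends to [0], it is nonpositive and [gamma] decreases to
    a limit [l >= 0].  Positive definiteness needs no integral representation of
    [gamma]: let [L] be the linear functional on polynomials with
    [L(X^n) = gamma n].  The polynomial [p - p(1) X^N] vanishes at [1], so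
    conditional positive definiteness gives
    [0 <= L(p^2) - 2 p(1) L(p X^N) + p(1)^2 gamma(2N)], and letting [N] grow
    yields [L(p^2) >= l p(1)^2 >= 0]. *)
Require Import Defs.
From mathcomp Require Import measurable_realfun ring lra zify.

Local Open Scope classical_set_scope.
Local Open Scope ring_scope.

(** * Integration against a finite measure with compact support *)

Section MeasureSupport.
Context {R : realType}.
Variable nu : {finite_measure set (measurableTypeR R) -> \bar R}.

(** Each point off the support has a null open neighbourhood, hence lies in a null interval with
    rational endpoints, and there are countably many of these. Closedness makes the complement
    measurable. *)
Lemma measure_supp_null : closed (measure_supp nu) ->
  nu (~` measure_supp nu) = 0%E.
Proof.
move=> clK.
(* Enumerates the null rational intervals; a natural number coding no pair, or an interval of
   nonzero measure, contributes [set0]. *)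
pose F (n : nat) : set R :=
  if unpickle n is Some (p, q) then
    if nu `]ratr p, ratr q[%classic == 0%E then `]ratr p, ratr q[%classic
    else set0
  else set0.
have F0 k : nu.-negligible (F k).
  rewrite /F; case: unpickle => [[p q]|]; last exact: negligible_set0.
  case: eqP => [pq0|_]; last exact: negligible_set0.
  by apply/negligibleP => //; exact: measurable_itv.
have mC : measurable (~` measure_supp nu : set (measurableTypeR R)).
  by apply: open_measurable; exact: closed_openC.
apply/(@negligibleP _ _ _ nu _ mC).
apply: negligibleS (negligible_bigcup F0) => x /=.
move=> /existsNP[U /not_implyP[oU /not_implyP[Ux /negP]]].
rewrite -leNgt measure_le0 => /eqP nuU0.
have /nbhs_ballP[e /= e0 xeU] : nbhs x U by exact: open_nbhs_nbhs.
have [p] : exists p : rat, ratr p \in `]x - e, x[.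
  by apply: rat_in_itvoo; rewrite ltrBlDr ltrDl.
rewrite in_itv /= => /andP[ep px].
have [q] : exists q : rat, ratr q \in `]x, x + e[.
  by apply: rat_in_itvoo; rewrite ltrDl.
rewrite in_itv /= => /andP[xq qe].
exists (pickle (p, q)); [by []|rewrite /F pickleK].
have -> : nu `]ratr p, ratr q[%classic = 0%E.
  apply: (@subset_measure0 _ _ _ nu _ U) => //.
  - by apply: open_measurable.
  - move=> y /=; rewrite in_itv /= => /andP[py yq]; apply: xeU.
    by rewrite /ball /= ltr_distl; apply/andP; split; lra.
by rewrite eqxx /= in_itv /= px xq.
Qed.

Hypothesis compact_supp : compact (measure_supp nu).

Let closed_supp : closed (measure_supp nu).
Proof. exact: (compact_closed (@Rhausdorff R)). Qed.

Let measurable_supp : measurable (measure_supp nu : set (measurableTypeR R)).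
Proof. exact: closed_measurable. Qed.

(** Boundedness on the compact support suffices, as [nu] is finite and vanishes off the support. *)
Lemma continuous_integrable_compact_supp (f : R -> R) : continuous f ->
  nu.-integrable setT (EFin \o f).
Proof.
move=> cf.
have mf : measurable_fun setT (f : measurableTypeR R -> _).
  exact: continuous_measurable_fun.
apply: (iffRL (@negligible_integrable _ _ _ nu setT (~` measure_supp nu)
                 _ _ _ _ _)) => //.
- exact: measurableC.
- exact/measurable_EFinP.
- exact: measure_supp_null.
rewrite setTD setCK; apply: measurable_bounded_integrable => //.
- by rewrite ltey_eq fin_num_measure.
- apply: (@measurable_funS _ _ _ _ setT) => //.
have /compact_bounded[M [Mr MB]] : compact (f @` measure_supp nu).
  by apply: continuous_compact => //; exact: continuous_subspaceT.
by exists M; split => // y My x Kx; apply: (MB y My); exists x.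
Qed.

Lemma Rintegral_ge0_supp (f : R -> R) : continuous f ->
  (forall x, measure_supp nu x -> 0 <= f x) -> 0 <= \int[nu]_x f x.
Proof.
move=> cf f0; rewrite /Rintegral.
rewrite (@negligible_integral _ _ _ nu setT (~` measure_supp nu)) //.
- by rewrite setTD setCK; apply: Rintegral_ge0.
- exact: measurableC.
- exact: continuous_integrable_compact_supp.
- exact: measure_supp_null.
Qed.

End MeasureSupport.

(** * Second differences of the integral representation *)

Lemma Qpoly_second_difference (R : realType) (n : nat) :
  Qpoly R n.+2 = Qpoly R n.+1 + Qpoly R n.+1 - Qpoly R n + 'X^n.
Proof.
(* In closed form Q_n(x) = (x^n - 1 - n(x - 1)) / (x - 1)^2, whose second difference in n is x^n. On
   coefficients, n - j - 1 is affine in n, so only j = n contributes, where [Qpoly R n.+2] alone is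
   nonzero. *)
apply/polyP => j; rewrite !coefE /=.
case: (ltngtP j n) => [jn|nj|->].
- have -> : (j < n.+1)%N by lia.
  (* For j = n - 1 the coefficient of [Qpoly R n] is cut off, but the affine formula would give 0 as
     well. *)
  have [jn1|] := boolP (j < n.-1)%N; last first.
    move=> jn1; have -> : (n.+2 - j - 1 = 2)%N by lia.
    have -> : (n.+1 - j - 1 = 1)%N by lia.
    by rewrite addr0 subr0.
  have -> : (n.+2 - j - 1 = (n - j - 1).+2)%N by lia.
  have -> : (n.+1 - j - 1 = (n - j - 1).+1)%N by lia.
  by rewrite -!natr1 mulr0n; move: (n - j - 1)%N => m; ring.
- have -> : (j < n.+1)%N = false by lia.
  have -> : (j < n.-1)%N = false by lia.
  by rewrite !addr0 subr0.
- have -> : (n < n.-1)%N = false by lia.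
  by rewrite ltnS leqnn -addn2 addKn addr0 subr0 add0r.
Qed.

Lemma second_difference_ge0 (R : realType) (gamma : R^nat) (b c : R)
    (nu : {finite_measure set (measurableTypeR R) -> \bar R}) :
  representing_triplet gamma b c nu ->
  measure_supp nu `<=` [set x | 0 <= x] ->
  forall n, gamma n.+1 - gamma n <= gamma n.+2 - gamma n.+1.
Proof.
move=> [c0 cK _ gammaE] K0 n.
have iP (p : {poly R}) : nu.-integrable setT (EFin \o horner p).
  by apply: continuous_integrable_compact_supp => //; exact: continuous_horner.
have QE : \int[nu]_x (Qpoly R n.+2).[x] =
    \int[nu]_x (Qpoly R n.+1).[x] + \int[nu]_x (Qpoly R n.+1).[x]
    - \int[nu]_x (Qpoly R n).[x] + \int[nu]_x 'X^n.[x].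
  rewrite -RintegralD // -RintegralB //; last first.
    by have := iP (Qpoly R n.+1 + Qpoly R n.+1);
       congr (_.-integrable _ _); apply/funext => x /=; rewrite hornerD.
  rewrite -RintegralD //; last first.
    by have := iP (Qpoly R n.+1 + Qpoly R n.+1 - Qpoly R n);
       congr (_.-integrable _ _); apply/funext => x /=; rewrite !hornerE.
  rewrite Qpoly_second_difference; congr Rintegral.
  by apply/funext => x /=; rewrite !(hornerD, hornerN).
have X0 : 0 <= \int[nu]_x 'X^n.[x].
  apply: Rintegral_ge0_supp => //; first exact: continuous_horner.
  by move=> x /K0 /= x0; rewrite hornerXn exprn_ge0.
rewrite (gammaE n.+2) (gammaE n.+1) (gammaE n) QE -!natr1.
rewrite -subr_ge0; set J := \int[nu]_x _ in X0 *.
by rewrite (_ : _ - _ = c + c + J); [lra | ring].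
Qed.

(** * The functional L and positivity on squares *)

Section RieszFunctional.
Context {R : realType}.
Variable gamma : R^nat.

Definition riesz (p : {poly R}) : R := \sum_(i < size p) p`_i * gamma i.

Lemma riesz_widen n (p : {poly R}) : (size p <= n)%N ->
  riesz p = \sum_(i < n) p`_i * gamma i.
Proof.
move=> pn; rewrite /riesz (big_ord_widen _ (fun i => p`_i * gamma i) pn).
rewrite big_mkcond /=; apply: eq_bigr => i _.
by case: ltnP => // /leq_sizeP ->; rewrite ?mul0r.
Qed.

Lemma rieszD : {morph riesz : p q / p + q}.
Proof.
move=> p q; pose n := maxn (size p) (size q).
rewrite (@riesz_widen n p) ?leq_maxl // (@riesz_widen n q) ?leq_maxr //.
rewrite (@riesz_widen n) ?size_polyD // -big_split /=.
by apply: eq_bigr => i _; rewrite coefD mulrDl.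
Qed.

Lemma rieszZ a p : riesz (a *: p) = a * riesz p.
Proof.
rewrite (@riesz_widen (size p)) ?size_scale_leq // mulr_sumr.
by apply: eq_bigr => i _; rewrite coefZ mulrA.
Qed.

Lemma rieszXn n : riesz 'X^n = gamma n.
Proof.
rewrite (@riesz_widen n.+1) ?size_polyXn // big_ord_recr /= coefXn eqxx mul1r.
rewrite big1 ?add0r // => i _; rewrite coefXn.
by rewrite (ltn_eqF (ltn_ord i)) mul0r.
Qed.

Lemma riesz_sum n (F : 'I_n -> {poly R}) :
  riesz (\sum_(i < n) F i) = \sum_(i < n) riesz (F i).
Proof.
by apply: (big_morph riesz rieszD); rewrite /riesz size_poly0 big_ord0.
Qed.

(** Dictionary between Hankel forms in [gamma] and values of L on products of polynomials. *)
Lemma riesz_mul n (a b : 'I_n -> R) :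
  riesz ((\sum_(i < n) a i *: 'X^i) * (\sum_(i < n) b i *: 'X^i)) =
  \sum_(i < n) \sum_(j < n) gamma (i + j)%N * a i * b j.
Proof.
rewrite big_distrlr /= riesz_sum; apply: eq_bigr => i _.
rewrite riesz_sum; apply: eq_bigr => j _.
by rewrite -scalerAl -scalerAr -exprD !rieszZ rieszXn; ring.
Qed.

(** The coefficients of p sum to p(1), so vanishing at 1 is the constraint in [CPD], and the Hankel
    form at these coefficients is L(p^2). *)
Lemma CPD_riesz_ge0 (p : {poly R}) : CPD gamma -> p.[1] = 0 ->
  0 <= riesz (p ^+ 2).
Proof.
move=> cpd p1; pose n := size p.
(* The extra top coefficient is 0; it gives the nonempty index range of [CPD] even for p = 0. *)
pose a (i : 'I_n.+1) := p`_i.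
have pE : p = \sum_(i < n.+1) a i *: 'X^i.
  by rewrite -poly_def; apply/polyP => i; rewrite coef_poly;
     case: ltnP => // /ltnW /leq_sizeP ->.
have /cpd : \sum_(i < n.+1) ((a i)%:C)%C = 0 :> R[i].
  rewrite -rmorph_sum /= (_ : \sum_(i < n.+1) a i = 0) ?rmorph0 //.
  rewrite -[RHS]p1 [in RHS]pE horner_sum; apply: eq_bigr => i _.
  by rewrite hornerZ hornerXn expr1n mulr1.
rewrite expr2 pE riesz_mul -lecR rmorph_sum /= rmorph0 => h.
apply: etrans h; congr (0 <= _); apply: eq_bigr => i _.
rewrite rmorph_sum; apply: eq_bigr => j _.
by rewrite !rmorphM /= conj_Creal ?complex_real.
Qed.

Lemma CPD_cvg_riesz_ge (p : {poly R}) (l : R) : CPD gamma ->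
  gamma @ \oo --> l -> l * p.[1] ^+ 2 <= riesz (p ^+ 2).
Proof.
move=> cpd gammal; pose s := p.[1].
(* The lower bound for L(p^2) obtained by expanding 0 <= L((p - s X^N)^2). *)
pose v N := s * riesz (p * 'X^N) *+ 2 - s ^+ 2 * gamma (N + N)%N.
have vE N : v N <= riesz (p ^+ 2).
  have : 0 <= riesz ((p - s *: 'X^N) ^+ 2).
    by apply: CPD_riesz_ge0 => //;
       rewrite hornerD hornerN hornerZ hornerXn expr1n mulr1 subrr.
  have -> : (p - s *: 'X^N) ^+ 2 =
      p ^+ 2 + (- (s *+ 2)) *: (p * 'X^N) + s ^+ 2 *: 'X^(N + N).
    by rewrite -!mul_polyC exprD rmorphN rmorphMn /= rmorphXn /=; ring.
  rewrite !rieszD !rieszZ rieszXn /v; lra.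
have rE N : riesz (p * 'X^N) = \sum_(i < size p) p`_i * gamma (i + N)%N.
  rewrite -{1}[p]coefK poly_def mulr_suml riesz_sum; apply: eq_bigr => i _.
  by rewrite -scalerAl -exprD rieszZ rieszXn.
(* L(p X^N) is a combination of shifts of [gamma] whose fixed coefficients sum to s. *)
have rl : riesz (p * 'X^N) @[N --> \oo] --> s * l.
  rewrite (_ : s * l = \sum_(i < size p) p`_i * l); last first.
    by rewrite -mulr_suml /s horner_coef;
       under eq_bigr do rewrite expr1n mulr1.
  under eq_fun do rewrite rE.
  apply: cvg_big => [|i _]; first exact: add_continuous.
  apply: cvgM; first exact: cvg_cst.
  by under eq_fun do rewrite addnC; move: gammal; rewrite -(cvg_shiftn i).
have gl : gamma (N + N)%N @[N --> \oo] --> l.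
  apply: cvg_comp gammal.
  apply/cvgnyPge => A; exists A => // m /= Am.
  by rewrite (leq_trans Am) ?leq_addr.
have vl : v N @[N --> \oo] --> (s * (s * l)) *+ 2 - s ^+ 2 * l.
  apply: cvgB; last by apply: cvgM => //; exact: cvg_cst.
  by apply: cvgMn; apply: cvgM => //; exact: cvg_cst.
rewrite (_ : l * _ = (s * (s * l)) *+ 2 - s ^+ 2 * l); last by rewrite /s; ring.
rewrite -(cvg_lim _ vl) //; apply: limr_le; last exact: nearW.
by apply/cvg_ex; eexists; exact: vl.
Qed.

(** With real and imaginary parts of [lam] as coefficients of real polynomials A and B, the
    Hermitian form equals L(A^2) + L(B^2). *)
Lemma riesz_PD : (forall p : {poly R}, 0 <= riesz (p ^+ 2)) -> PD gamma.
Proof.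
move=> rge0 k lam.
pose a i := complex.Re (lam i); pose b i := complex.Im (lam i).
suff -> : \sum_(i < k.+1) \sum_(j < k.+1)
    ((gamma (i + j)%N)%:C * lam i * (lam j)^*)%C =
  ((\sum_(i < k.+1) \sum_(j < k.+1) gamma (i + j)%N * a i * a j +
    \sum_(i < k.+1) \sum_(j < k.+1) gamma (i + j)%N * b i * b j)%:C)%C.
  by rewrite -!riesz_mul -!expr2 lecR addr_ge0.
have -> : \sum_(i < k.+1) \sum_(j < k.+1)
    ((gamma (i + j)%N)%:C * lam i * (lam j)^*)%C =
  ((\sum_(i < k.+1) \sum_(j < k.+1) gamma (i + j)%N * a i * a j +
    \sum_(i < k.+1) \sum_(j < k.+1) gamma (i + j)%N * b i * b j)%:C +
  'i * (\sum_(i < k.+1) \sum_(j < k.+1) gamma (i + j)%N * b i * a j -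
    \sum_(i < k.+1) \sum_(j < k.+1) gamma (i + j)%N * a i * b j)%:C)%C.
  rewrite -!big_split /= -sumrB !rmorph_sum mulr_sumr -big_split /=.
  apply: eq_bigr => i _; rewrite -!big_split -sumrB !rmorph_sum mulr_sumr.
  rewrite -big_split /=; apply: eq_bigr => j _; rewrite /a /b.
  case: (lam i) (lam j) => [ai bi] [aj bj] /=.
  by apply/eqP; rewrite eq_complex /=; apply/andP; split; apply/eqP; ring.
(* The imaginary part cancels because [gamma (i + j)] is symmetric in i and j. *)
rewrite [X in (X - _)%:C%C]exchange_big /=.
rewrite [X in 'i%C * X](_ : _ = 0) ?mulr0 ?addr0 //.
rewrite (_ : _ - _ = 0) //; apply/eqP; rewrite subr_eq0; apply/eqP.
by apply: eq_bigr => i _; apply: eq_bigr => j _; rewrite addnC; ring.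
Qed.

End RieszFunctional.

Lemma CPD_cvg_PD (R : realType) (gamma : R^nat) (l : R) : CPD gamma ->
  gamma @ \oo --> l -> 0 <= l -> PD gamma.
Proof.
move=> cpd gammal l0; apply: riesz_PD => p.
by apply: le_trans (CPD_cvg_riesz_ge _ p _ cpd gammal); rewrite mulr_ge0 ?sqr_ge0.
Qed.

(** * Monotonicity, convergence and positivity *)

Theorem corollary2p3p4 (R : realType) (gamma : R^nat) (b c : R)
    (nu : {finite_measure set (measurableTypeR R) -> \bar R})
    (gamma_cpd : CPD gamma)
    (gamma_growth : exp_growth gamma)
    (gamma_triplet : representing_triplet gamma b c nu)
    (supp_ge0 : measure_supp nu `<=` [set x | 0 <= x])
    (gamma_ge0 : \forall n \near \oo, 0 <= gamma n) :
  [<-> (fun n => gamma n.+1 - gamma n) @ \oo --> (0 : R);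
       nonincreasing_seq gamma;
       cvgn gamma]
  /\ ((fun n => gamma n.+1 - gamma n) @ \oo --> (0 : R) ->
      PD gamma /\ forall n : nat, 0 <= gamma n).
Proof.
have D12 : (fun n => gamma n.+1 - gamma n) @ \oo --> (0 : R) ->
    nonincreasing_seq gamma.
  move=> d0; apply/nonincreasing_seqP => n.
  have /nondecreasing_seqP nd := second_difference_ge0 _ _ _ _ _ gamma_triplet supp_ge0.
  have cd : cvgn (fun n => gamma n.+1 - gamma n) by apply/cvg_ex; exists 0.
  (* The nondecreasing first difference stays below its limit 0. *)
  by have := nondecreasing_cvgn_le nd cd n; rewrite (cvg_lim _ d0) // subr_le0.
have D23 : nonincreasing_seq gamma -> cvgn gamma.
  (* The lower bound 0 is only eventual, which suffices for convergence. *)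
  move=> gi; apply: (near_nonincreasing_is_cvgn (m := 0)) => //.
  by near=> n => x y; exact: gi.
have D31 : cvgn gamma -> (fun n => gamma n.+1 - gamma n) @ \oo --> (0 : R).
  move=> /cvg_ex[l gl]; rewrite -(subrr l); apply: cvgB => //.
  by move: gl; rewrite -cvg_shiftS.
split; first by tfae.
move=> /D12 gi; have cg := D23 gi.
have l0 : 0 <= limn gamma by exact: limr_ge.
split; first exact: CPD_cvg_PD _ _ _ gamma_cpd cg l0.
(* Staying above the limit extends nonnegativity from large n to all n. *)
by move=> n; apply: le_trans l0 _; exact: nonincreasing_cvgn_ge.
Unshelve. all: by end_near.
Qed.
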